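(* If $G$ is a stepwise transmission irregular (STI) graph of order $n$, then $$\max\{\mathrm{Tr}_G(v) : v\in V(G)\} \le \frac{n^2-1}{4}.$$ Moreover, the equality holds if and only if $G\cong G_n$.
   Context: All graphs are simple and connected. The order of a graph is its number of vertices. The distance $d_G(u,v)$ is the number of edges on a shortest $u,v$-path. The transmission $\mathrm{Tr}_G(v)$ of a vertex $v$ is the sum of the distances between $v$ and all other vertices of $G$. A graph $G$ is stepwise transmission irregular (STI) if $|\mathrm{Tr}_G(u)-\mathrm{Tr}_G(v)|=1$ for every edge $uv\in E(G)$. For $n\ge 5$, the graph $G_n$ (hatted cycle) has vertex set $\{v_1,\ldots,v_n\}$, where $v_1,\ldots,v_{n-1}$ (in this cyclic order) induce a cycle of length $n-1$, and $v_n$ is adjacent exactly to $v_1$ and $v_3$.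
   Formalization: The order n is assumed to be at least 5: the path on three vertices is STI with maximum transmission 3 > (9-1)/4 = 2, so the bound fails for n = 3, and G_n is defined only for n ≥ 5. *)

(* Defs.v *)
From mathcomp Require Import all_boot all_order all_algebra.

Set Implicit Arguments.
Unset Strict Implicit.
Unset Printing Implicit Defensive.

(* A graph is an adjacency relation [e] on a finite type of vertices; it is
   simple when [e] is symmetric and irreflexive. *)
Definition simple_graph (T : finType) (e : rel T) : Prop :=
  symmetric e /\ irreflexive e.

Definition connected_graph (T : finType) (e : rel T) : Prop :=
  forall x y : T, connect e x y.

Definition has_path (T : finType) (e : rel T) (u v : T) (k : nat) : bool :=
  [exists p : k.-tuple T, [&& path e u p, uniq (u :: p) & last u p == v]].

(* A path without repeated vertices has fewer than #|T| edges, so the search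
   finds the least length of a u,v-path.  If there is no such path the value
   is the junk value #|T|. *)
Definition dist (T : finType) (e : rel T) (u v : T) : nat :=
  find (has_path e u v) (iota 0 #|T|).

Definition Tr (T : finType) (e : rel T) (v : T) : nat :=
  \sum_(u : T | u != v) dist e v u.

Definition STI (T : finType) (e : rel T) : Prop :=
  forall u v : T, e u v -> `|Tr e u - Tr e v|%N = 1%N.

(* The hatted cycle G_n, for n >= 5; vertex v_(i+1) is i : 'I_n.  The first
   disjunct gives the cycle edges v_1 v_2, ..., v_(n-2) v_(n-1), v_(n-1) v_1,
   the second the two edges v_n v_1 and v_n v_3. *)
Definition hatted_arc (n : nat) (i j : 'I_n) : bool :=
  ((i < n.-1) && (j == i.+1 %% n.-1 :> nat))
  || ((i == n.-1 :> nat) && ((j == 0 :> nat) || (j == 2 :> nat))).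

Definition hatted_cycle (n : nat) : rel 'I_n :=
  fun i j => hatted_arc i j || hatted_arc j i.

Definition graph_iso (T U : finType) (e : rel T) (e' : rel U) : Prop :=
  exists2 f : T -> U, bijective f & forall x y : T, e' (f x) (f y) = e x y.

(* Main.v *)
Require Import Defs.
From mathcomp Require Import all_boot all_order all_algebra.
From mathcomp Require Import zify ring.

(* In an STI graph the transmissions of adjacent vertices have opposite
   parities, so d(u,v) = Tr u + Tr v mod 2; summing over u shows that the two
   parity classes have sizes of opposite parity, hence n = 2k + 1 is odd.
   If x is a neighbour of a cut vertex c in a union B of components of G - c,
   then passing from c to x costs one more for every vertex outside B, so
   |Tr x - Tr c| = 1 forces n <= 2|B| + 1. Applied to both sides of c, and once
   more to x itself, this leaves only n = 3; so for n >= 5 there is no cut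
   vertex. Hence every distance level from v, except 0 and the last, has at
   least two vertices, and Tr v <= 2(1 + ... + k) = (n^2 - 1)/4.
   In the equality case the levels 1, ..., k have exactly two vertices. For a
   neighbour a of v, Tr a = Tr v - 1 means that exactly k + 1 vertices have a
   geodesic from v through a; for the two neighbours these sets share exactly
   the last level, and this determines all edges. *)

Set Implicit Arguments.
Unset Strict Implicit.
Unset Printing Implicit Defensive.

Lemma sum_double_sub m : \sum_(i < m) (m - i).*2 = m * m.+1.
Proof.
elim: m => [|m IH]; first by rewrite big_ord0.
rewrite big_ord_recl /= (eq_bigr (fun i : 'I_m => (m - i).*2)) ?IH; first lia.
by move=> i _; rewrite /bump /=; lia.
Qed.

(** * Graph distance in connected graphs *)

Section Distance.
Variables (T : finType) (e : rel T).
Hypotheses (e_sym : symmetric e) (e_conn : connected_graph e).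
Local Notation d := (dist e).

Lemma dist_le_path x p : path e x p -> d x (last x p) <= size p.
Proof.
move=> xp; case: (shortenP xp) => q xq uq qp.
have szq : size q < #|T| by move/card_uniqP: uq => /= <-; apply: max_card.
apply: leq_trans (uniq_leq_size (andP uq).2 qp).
rewrite leqNgt; apply/negP => /(before_find 0).
rewrite nth_iota // add0n => /negbT/negP; apply.
rewrite /has_path; apply/existsP.
by exists (in_tuple q); apply/and3P; split; rewrite ?eqxx.
Qed.

Lemma dist_path x y : exists p, [/\ path e x p, last x p = y & size p = d x y].
Proof.
have [p xp ->] := connectP (e_conn x y).
case: (shortenP xp) => q xq uq _.
have szq : size q < #|T| by move/card_uniqP: uq => /= <-; apply: max_card.
have hp : has (has_path e x (last x q)) (iota 0 #|T|).
  apply/hasP; exists (size q); first by rewrite mem_iota.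
  by apply/existsP; exists (in_tuple q); apply/and3P; split; rewrite ?eqxx.
have := nth_find 0 hp; rewrite -/(dist e x (last x q)).
rewrite nth_iota; last by rewrite has_find size_iota in hp.
case/existsP=> r /and3P[xr ur /eqP lr]; exists r; split=> //.
by rewrite size_tuple.
Qed.

Lemma dist_self x : d x x = 0.
Proof. by apply/eqP; rewrite -leqn0 (@dist_le_path x [::]). Qed.

Lemma dist_eq0 x y : (d x y == 0) = (x == y).
Proof.
apply/eqP/eqP=> [|->]; last exact: dist_self.
by have [[|z p] [_ /= <- <-]] := dist_path x y.
Qed.

Lemma dist_edge x y z : e y z -> d x z <= (d x y).+1.
Proof.
move=> yz; have [p [xp lp <-]] := dist_path x y.
have := @dist_le_path x (rcons p z).
by rewrite rcons_path last_rcons size_rcons xp lp; apply.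
Qed.

Lemma dist_le1 x y : e x y -> d x y <= 1.
Proof. by move=> xy; rewrite -(dist_self x) dist_edge. Qed.

Lemma dist_eq1 x y : d x y = 1 -> e x y.
Proof. by have [[|z [|? ?]] [/= + <- <-]] := dist_path x y => // /andP[]. Qed.

Lemma dist_pred x y : x != y -> exists2 z, e z y & d x y = (d x z).+1.
Proof.
move=> xy; have [p] := dist_path x y.
case: (lastP p) => [[_ /= xy'] | q z]; first by rewrite xy' eqxx in xy.
rewrite rcons_path last_rcons size_rcons => -[/andP[xq qz] zy dq].
rewrite zy in qz; exists (last x q) => //; apply/eqP.
by rewrite eqn_leq dist_edge // -dq ltnS dist_le_path.
Qed.

Lemma dist_lipschitz (h : T -> nat) x y :
  (forall u v, e u v -> h v <= (h u).+1) -> h y <= h x + d x y.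
Proof.
move=> lip; have [p [xp <- <-]] := dist_path x y.
elim/last_ind: p xp => [|p w IH]; first by rewrite addn0.
rewrite rcons_path last_rcons size_rcons addnS => /andP[xp pw].
by apply: leq_trans (lip _ _ pw) _; rewrite ltnS IH.
Qed.

Lemma dist_sym x y : d x y = d y x.
Proof.
suff le u v : d u v <= d v u by apply/eqP; rewrite eqn_leq !le.
have [p [vp lp <-]] := dist_path v u.
have := @dist_le_path u (rev (belast v p)).
rewrite -lp rev_path size_rev size_belast.
have -> : last (last v p) (rev (belast v p)) = v.
  by case: p {vp lp} => //= z p; rewrite rev_cons last_rcons.
apply; rewrite (@eq_path _ (fun z : T => e^~ z) e) // => a b; exact: e_sym.
Qed.

Lemma dist_edgel x y z : e x y -> d x z <= (d y z).+1.
Proof. by move=> xy; rewrite ![d _ z]dist_sym dist_edge // e_sym. Qed.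

Lemma TrE v : Tr e v = \sum_u d v u.
Proof. by rewrite [RHS](bigD1 v) //= dist_self. Qed.

Lemma sum_card (A : {set T}) : \sum_u (u \in A : nat) = #|A|.
Proof.
by rewrite -sum1_card [RHS]big_mkcond; apply: eq_bigr => u _; case: (u \in A).
Qed.

(** A path leaving [B] must pass through [c], and it takes at least one edge to get there. *)
Lemma dist_cut c (B : {set T}) x a :
  c \notin B -> (forall y z, y \in B -> e y z -> z \in B \/ z = c) ->
  x \in B -> a \notin B -> (d c a).+1 <= d x a.
Proof.
move=> cB closB xB aB; have [p [xp lp <-]] := dist_path x a.
elim: p x xB xp lp => [x xB _ /= xa|y p IH x xB /= /andP[xy yp] lp].
  by rewrite -xa xB in aB.
rewrite ltnS; have [yB|yc] := closB _ _ xB xy; first exact/ltnW/(IH y).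
by rewrite -yc -lp; apply: dist_le_path.
Qed.

(** Take a vertex of [B] nearest to [c]: its predecessor on a geodesic from [c] is too close to lie
    in [B], so it is [c]. *)
Lemma cut_neighbour c (B : {set T}) b :
  c \notin B -> (forall y z, y \in B -> e y z -> z \in B \/ z = c) ->
  b \in B -> exists2 x, x \in B & e c x.
Proof.
move=> cB closB bB.
case: (arg_minnP (d c) bB) => x xB minx; exists x => //.
have cx : c != x by apply: contraNneq cB => ->.
have [z zx dz] := dist_pred cx.
have [zB|<- //] := closB x z xB (etrans (e_sym _ _) zx).
by have := minx z zB; rewrite dz ltnn.
Qed.

End Distance.

(** * Parity of transmissions and odd order *)

Section Stepwise.
Variables (T : finType) (e : rel T) (n : nat).
Hypotheses (e_sym : symmetric e) (e_conn : connected_graph e).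
Hypotheses (order_n : #|T| = n) (e_STI : STI e).
Local Notation d := (dist e).
Local Notation Tr := (Tr e).
Local Notation TrE := (@TrE T e).
Local Notation dist_edge := (dist_edge e_conn).
Local Notation dist_edgel := (dist_edgel e_sym e_conn).

Lemma Tr_edge u v : e u v -> Tr u = (Tr v).+1 \/ Tr v = (Tr u).+1.
Proof. by move=> /e_STI; lia. Qed.

(** Each edge of a geodesic flips the parity of the transmission. In particular the graph is
    bipartite, so no edge lies inside a distance level. *)
Lemma odd_dist u v : odd (d u v) = odd (Tr u) (+) odd (Tr v).
Proof.
have [p [up <- <-]] := dist_path e_conn u v.
elim/last_ind: p up => [|p w IH]; first by rewrite addbb.
rewrite rcons_path last_rcons size_rcons /= => /andP[up pw].
rewrite IH //; have [->|->] := Tr_edge pw => /=; by case: odd; case: odd.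
Qed.

Lemma edge_dist_neq u v w : e u v -> d u w = (d v w).+1 \/ d v w = (d u w).+1.
Proof.
move=> uv; have vu : e v u by rewrite e_sym.
have := dist_edgel w uv; have := dist_edgel w vu.
have := odd_dist u w; have := odd_dist v w; have [->|->] := Tr_edge uv => /=; lia.
Qed.

Lemma edge_level v x y : e x y -> d v x = (d v y).+1 \/ d v y = (d v x).+1.
Proof. by move=> /(edge_dist_neq v); rewrite !(dist_sym e_sym e_conn v). Qed.

Lemma odd_order : 1 < n -> odd n.
Proof.
rewrite -order_n => T_gt1.
pose A := [set u | odd (Tr u)].
(* Modulo 2, [Tr v] counts the vertices whose transmission has the other parity. *)
have parity v : odd (Tr v) = odd #|if odd (Tr v) then ~: A else A|.
  rewrite {1}TrE -sum_card.
  have: forall u, odd (d v u) = odd (u \in if odd (Tr v) then ~: A else A).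
    move=> u; rewrite odd_dist.
    by case: (odd (Tr v)); rewrite !inE oddb //; case: odd.
  move=> par; elim/big_ind2: _ => //= x1 x2 y1 y2.
  by rewrite !oddD => -> ->.
have [x [y xy]] : exists x y, x != y :> T.
  by have /card_gt1P[x [y [_ _ ?]]] := T_gt1; exists x, y.
have [z zy _] := dist_pred e_conn xy.
have := parity z; have := parity y; have := cardsC A.
have [->|->] := Tr_edge zy => /=; case: odd => /=; lia.
Qed.

(** * Absence of cut vertices *)

Lemma card_compl (A : {set T}) : #|A| + #|~: A| = n.
Proof. by rewrite cardsC. Qed.

(** Summing the pointwise bound [le] gives [Tr c + #|~: B| <= Tr x + #|B|], while
    [Tr x <= Tr c + 1]. If [n] attains the bound, both are equalities, hence so is [le] at every
    vertex. *)
Lemma cut_leq c (B : {set T}) x :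
  c \notin B -> (forall y z, y \in B -> e y z -> z \in B \/ z = c) ->
  x \in B -> e c x ->
  n <= #|B|.*2.+1 /\
  (n = #|B|.*2.+1 -> forall u, u \in B -> d c u = (d x u).+1).
Proof.
move=> cB closB xB cx.
have le u : d c u + (u \in ~: B) <= d x u + (u \in B)
    ?= iff (d c u + (u \in ~: B) == d x u + (u \in B)).
  split=> //; rewrite inE; case: (boolP (u \in B)) => uB /=.
    by rewrite addn0 addn1 dist_edgel.
  by rewrite addn0 addn1 (dist_cut e_conn cB).
have := leqif_sum (fun u (_ : predT u) => le u).
rewrite !big_split /= !sum_card -!TrE // => -[].
have := card_compl B; have := Tr_edge cx => Trcx cB' lesum eqsum; split; first lia.
move=> nB u uB; move: eqsum; case: eqP => [_ /esym|]; last by lia.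
move=> /forallP/(_ u) /=; rewrite inE uB /=; lia.
Qed.

Hypothesis n_ge5 : 5 <= n.

Lemma no_cut_vertex c (B : {set T}) a b :
  c \notin B -> (forall y z, y \in B -> e y z -> z \in B \/ z = c) ->
  b \in B -> a \notin B -> a != c -> False.
Proof.
move=> cB closB bB aB ac.
pose A := ~: (c |: B).
have cA : c \notin A by rewrite !inE eqxx.
have closA y z : y \in A -> e y z -> z \in A \/ z = c.
  rewrite !inE !negb_or => /andP[yc yB] yz.
  case: (eqVneq z c) => [|zc]; [by right | left].
  apply/negP=> zB; rewrite e_sym in yz.
  by have [/(negP yB)|/eqP/(negP yc)] := closB _ _ zB yz.
have aA : a \in A by rewrite !inE negb_or ac.
have [x xB cx] := cut_neighbour e_sym e_conn cB closB bB.
have [x' xA cx'] := cut_neighbour e_sym e_conn cA closA aA.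
have [leB eqB] := cut_leq cB closB xB cx.
have [leA _] := cut_leq cA closA xA cx'.
have cAB : #|c |: B| + #|A| = n := card_compl (c |: B).
rewrite cardsU1 cB in cAB.
have n_odd : odd n by apply: odd_order; apply: leq_trans n_ge5.
have nB : n = #|B|.*2.+1 by clear - leA leB cAB n_odd; lia.
have {}eqB := eqB nB.
(* By [eqB] every vertex of [B] is one step closer to [x] than to [c]. So [x] is the only neighbour
   of [c] in [B], and it cuts off [B'] in turn. *)
have xuniq z : z \in B -> e c z -> z = x.
  move=> zB /(dist_le1 e_conn); rewrite eqB // ltnS leqn0.
  by rewrite dist_eq0 // => /eqP.
pose B' := B :\ x.
have xB' : x \notin B' by rewrite !inE eqxx.
have closB' y z : y \in B' -> e y z -> z \in B' \/ z = x.
  rewrite !inE => /andP[yx yB] yz.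
  case: (eqVneq z x) => [|zx]; [by right | left].
  have [//|zc] := closB _ _ yB yz.
  by rewrite zc e_sym in yz; rewrite (xuniq y) ?eqxx in yx.
have cB' : #|B| = #|B'|.+1 by rewrite (cardsD1 x B) xB.
have [b' b'B'] : exists b', b' \in B'.
  by apply/card_gt0P; clear - n_ge5 nB cB'; lia.
have [y yB xy] := cut_neighbour e_sym e_conn xB' closB' b'B'.
(* The bound at [x] needs [n <= #|B'|.*2.+1], which is two less than [n]. *)
by have [le _] := cut_leq xB' closB' yB xy; clear - le nB cB'; lia.
Qed.

(** * Distance levels and the upper bound *)

Lemma level_exists v u i : i <= d v u -> exists w, d v w = i.
Proof.
move=> iu; have [m Em] : exists m, d v u = m + i by exists (d v u - i); lia.
elim: m u Em {iu} => [|m IH] u Em; first by exists u.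
have vu : v != u by rewrite -(dist_eq0 e_conn) Em.
by have [z _ dz] := dist_pred e_conn vu; apply: (IH z); lia.
Qed.

(** If [c] were alone on its level, it would separate [v] from the deeper vertices. *)
Lemma level_second v c u :
  0 < d v c < d v u -> exists2 x, x != c & d v x = d v c.
Proof.
case/andP=> c_gt0 c_lt.
have [x /andP[xc /eqP dx]|uniq_c] :=
    pickP [pred x | (x != c) && (d v x == d v c)].
  by exists x.
pose B := [set x | d v c < d v x].
case: (@no_cut_vertex c B v u); rewrite ?inE ?ltnn ?dist_self //.
- move=> y z; rewrite inE => dy; rewrite e_sym => /(dist_edge v) dz.
  rewrite inE; have [dz' |dz' |dz'] := ltngtP (d v c) (d v z); [by left | lia |].
  by right; apply/eqP; have /negbT := uniq_c z; rewrite /= dz' eqxx andbT negbK.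
- by rewrite -(dist_eq0 e_conn) -lt0n.
Qed.

Variable k : nat.
Hypothesis n_k : n = k.*2.+1.

Definition beyond v i := [set u | i < d v u].
Definition level v i := [set u | d v u == i].

Lemma card_beyond_split v i : #|beyond v i| = #|level v i.+1| + #|beyond v i.+1|.
Proof.
have -> : beyond v i = level v i.+1 :|: beyond v i.+1.
  by apply/setP=> u; rewrite !inE; lia.
have/leqifP := leq_card_setU (level v i.+1) (beyond v i.+1).
case: ifP => [_ /eqP //|/negP[]].
by rewrite -setI_eq0; apply/eqP/setP=> u; rewrite !inE; lia.
Qed.

Lemma card_beyond0 v : #|beyond v 0| = k.*2.
Proof.
have := card_compl (beyond v 0).
have -> : ~: beyond v 0 = [set v].
  by apply/setP=> u; rewrite !inE -leqNgt leqn0 dist_eq0 // eq_sym.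
by rewrite cards1; lia.
Qed.

(** As long as deeper vertices remain, removing a level removes at least two vertices. *)
Lemma card_beyond v i : #|beyond v i| <= (k - i).*2.
Proof.
elim: i => [|i IH]; first by rewrite card_beyond0 subn0.
have [->|[u]] := set_0Vmem (beyond v i.+1); first by rewrite cards0.
rewrite inE => iu; have [c dc] := level_exists (ltnW iu).
have [|x xc dx] := @level_second v c u; first by rewrite dc.
have : #|[set x; c]| <= #|level v i.+1|.
  by apply/subset_leq_card/subsetP=> y; rewrite !inE => /orP[]/eqP ->; lia.
by rewrite cards2 xc; have := card_beyond_split v i; lia.
Qed.

Lemma dist_max v u : d v u <= k.
Proof.
have := card_beyond v k; rewrite subnn leqn0 cards_eq0 => /eqP/setP/(_ u).
by rewrite !inE => /negbT; rewrite -leqNgt.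
Qed.

(** Double counting: [d v u] is the number of [i < k] with [i < d v u]. *)
Lemma Tr_beyond v : Tr v = \sum_(i < k) #|beyond v i|.
Proof.
rewrite TrE //; under [RHS]eq_bigr => i _ do rewrite -sum_card.
rewrite exchange_big /=; apply: eq_bigr => u _.
under eq_bigr => i _ do rewrite inE.
have := dist_max v u; elim: (k) (d v u) => [|m IH] j; first by rewrite big_ord0; lia.
case: j => [_|j jm]; first by rewrite big1.
by rewrite big_ord_recl /= add1n {1}(IH j).
Qed.

Lemma Tr_leqif v :
  Tr v <= k * k.+1 ?= iff [forall i : 'I_k, #|beyond v i| == (k - i).*2].
Proof.
rewrite Tr_beyond -sum_double_sub; apply: leqif_sum => i _.
exact/leqif_eq/card_beyond.
Qed.

Lemma Tr_le v : Tr v <= k * k.+1.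
Proof. exact: Tr_leqif. Qed.

(* The vertices that have a geodesic from [v] through its neighbour [a]. *)
Definition side v a := [set u | d v u == (d a u).+1].

Lemma mem_side v u : v != u -> exists2 a, e v a & u \in side v a.
Proof.
move=> vu; rewrite eq_sym in vu.
have [a av dua] := dist_pred e_conn vu.
by exists a; rewrite 1?e_sym // inE !(dist_sym e_sym e_conn _ u) dua.
Qed.

Lemma side_closed v a x y :
  e v a -> x \in side v a -> e x y -> d v y = (d v x).+1 -> y \in side v a.
Proof.
rewrite !inE => va /eqP dx xy dy.
by have := dist_edgel y va; have := dist_edge a xy; lia.
Qed.

(** * Structure of the graphs attaining the bound *)

Section Extremal.
Variable v : T.
Hypothesis Tr_v : Tr v = k * k.+1.

Lemma card_level i : 0 < i <= k -> #|level v i| = 2.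
Proof.
case: i => // i /= ik.
have card_beyondE j : j <= k -> #|beyond v j| = (k - j).*2.
  rewrite leq_eqVlt => /predU1P[->|jk].
    by apply/eqP; rewrite subnn -leqn0; have := card_beyond v k; rewrite subnn.
  have [_] := Tr_leqif v; rewrite Tr_v eqxx => /esym/forallP/(_ (Ordinal jk))/eqP.
  by [].
have := card_beyond_split v i; rewrite !card_beyondE //; [lia | exact: ltnW].
Qed.

Lemma level_pair x y : 0 < d v x -> y != x -> d v y = d v x ->
  forall z, d v z = d v x -> z = x \/ z = y.
Proof.
move=> dx yx dy z dz.
have lv : [set x; y] = level v (d v x).
  apply/eqP; rewrite eqEcard cards2 eq_sym yx card_level ?dx ?dist_max // andbT.
  by apply/subsetP=> w; rewrite !inE => /orP[]/eqP ->; rewrite ?dy.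
have : z \in [set x; y] by rewrite lv inE dz.
by rewrite !inE => /orP[]/eqP; [left | right].
Qed.

Lemma level_other x : 0 < d v x -> exists2 y, y != x & d v y = d v x.
Proof.
move=> dx; have := @card_level (d v x); rewrite dx dist_max => /(_ isT).
move/eqP/cards2P=> [y [z [yz /setP lv]]].
have := lv x; have := lv y; have := lv z; rewrite !inE !eqxx orbT /=.
move=> /eqP dz /eqP dy /esym; case/orP=> /eqP ->.
  by exists z; rewrite 1?eq_sym // dz dy.
by exists y; rewrite // dz dy.
Qed.

Lemma top_exists : exists u, d v u = k.
Proof.
have : 0 < #|level v k| by rewrite card_level; lia.
by case/card_gt0P=> u; rewrite inE => /eqP; exists u.
Qed.

(** Otherwise the other vertex of the level of [x] would separate [v] from all deeper levels. *)
Lemma child x : 0 < d v x < k -> exists2 y, e x y & d v y = (d v x).+1.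
Proof.
case/andP=> dx dxk.
have [y /andP[xy /eqP dy]|nochild] :=
    pickP [pred y | e x y && (d v y == (d v x).+1)].
  by exists y.
have [c cx dc] := level_other dx; have [u du] := top_exists.
case: (@no_cut_vertex c (beyond v (d v x)) v u);
  rewrite ?inE ?dc ?du ?ltnn ?dist_self //.
- move=> y z; rewrite !inE => dy yz; have zy : e z y by rewrite e_sym.
  have [dz|dz|dz] := ltngtP (d v x) (d v z); [by left | have := dist_edge v zy; lia |].
  right; have [zx|//] := level_pair dx cx dc (esym dz).
  have := nochild y; rewrite /= -zx zy /=; have := dist_edge v zy; lia.
- by rewrite -(dist_eq0 e_conn) dc -lt0n.
Qed.

(** All neighbours of [y] lie on the two-vertex level [k.-1]; if [x] is not one of them, the other
    vertex [w] cuts [y] off. *)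
Lemma top_adj x y : d v x = k.-1 -> d v y = k -> e x y.
Proof.
move=> dx dy; have vy : v != y by rewrite -(dist_eq0 e_conn) dy; lia.
have [w wy dw] := dist_pred e_conn vy; have {dw} dw : d v w = d v x by lia.
have [//|nxy] := boolP (e x y); have wx : w != x by apply: contraNneq nxy => <-.
case: (@no_cut_vertex w [set y] x y); rewrite ?inE ?eqxx //.
- by apply/eqP=> wy'; rewrite wy' in dw; lia.
- move=> p z; rewrite inE => /eqP -> yz; right.
  have dx_gt0 : 0 < d v x by lia.
  have dz : d v z = d v x by have := edge_level v yz; have := dist_max v z; lia.
  by have [zx|//] := level_pair dx_gt0 wx dw dz; rewrite -zx e_sym yz in nxy.
- by apply/eqP=> xy; rewrite xy in dx; lia.
- by rewrite eq_sym.
Qed.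

Section Neighbour.
Variable a : T.
Hypothesis va : e v a.

Lemma side_level i : 0 < i <= k -> exists2 x, x \in side v a & d v x = i.
Proof.
elim: i => [//|[|i] IH] /= ik.
  have dva : d v a = 1.
    by have := dist_le1 e_conn va; have := edge_level v va; rewrite dist_self; lia.
  by exists a; rewrite // inE dva dist_self.
have [|x xa dx] := IH _; first exact: ltnW.
have [|y xy dy] := @child x; first by rewrite dx.
by exists y; [apply: side_closed xa xy dy | rewrite dy dx].
Qed.

Lemma side_top y : d v y = k -> y \in side v a.
Proof.
move=> dy; have [|x xa dx] := @side_level k.-1; first lia.
apply: (side_closed va xa); [exact: top_adj | lia].
Qed.

(** Moving from [v] to [a] lowers the distance by one on the side and raises it by one elsewhere; as
    [Tr v] is maximal, the net change is -1. *)
Lemma card_side : #|side v a| = k.+1.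
Proof.
have : \sum_u (d a u + (u \in side v a)) = \sum_u (d v u + (u \in ~: side v a)).
  apply: eq_bigr => u _; rewrite !inE.
  by have [-> | ->] := edge_dist_neq u va; lia.
rewrite !big_split /= !sum_card -!TrE //.
have := card_compl (side v a); have := Tr_edge va; have := Tr_le a; lia.
Qed.

End Neighbour.

(** The bit [s] tells the two vertices of a level apart, so level and bit are coordinates that
    determine the vertex and its adjacencies. *)
Lemma extremal_structure : exists s : T -> bool,
  (forall x y, 0 < d v x -> d v x = d v y -> s x = s y -> x = y) /\
  (forall x y, d v y = (d v x).+1 ->
     e x y = [|| d v x == 0, d v y == k | s x == s y]).
Proof.
have /eqP/cards2P[a [b [ab lv1]]] : #|level v 1| = 2 by apply: card_level; lia.
have nbr u : e v u = (u == a) || (u == b).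
  have : (u \in level v 1) = (u \in [set a; b]) by rewrite lv1.
  rewrite !inE => <-; apply/idP/eqP; last exact: dist_eq1.
  move=> vu; have := dist_le1 e_conn vu; have := edge_level v vu.
  by rewrite dist_self; lia.
have va : e v a by rewrite nbr eqxx.
have vb : e v b by rewrite nbr eqxx orbT.
have sideU : side v a :|: side v b = [set~ v].
  apply/setP=> u; rewrite !inE; case: (eqVneq u v) => [->|uv] /=.
    by rewrite !dist_self.
  rewrite eq_sym in uv; have [c] := mem_side uv.
  by rewrite nbr inE => /orP[]/eqP -> ->; rewrite ?orbT.
(* Two sides of size [k.+1] cover [k.*2] vertices, so they share exactly two: those of the last
   level. *)
have sideI : level v k = side v a :&: side v b.
  apply/eqP; rewrite eqEcard; apply/andP; split.
    by apply/subsetP=> u; rewrite in_set in_setI => /eqP du; rewrite !side_top.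
  have := cardsUI (side v a) (side v b).
  rewrite sideU cardsC1 order_n !card_side // card_level; lia.
have side_b u : 0 < d v u < k -> (u \in side v b) = (u \notin side v a).
  case/andP=> du duk; have uv : u != v by rewrite eq_sym -(dist_eq0 e_conn) -lt0n.
  have := congr1 (fun A : {set T} => u \in A) sideU.
  have := congr1 (fun A : {set T} => u \in A) sideI.
  rewrite /= in_setI in_setU in_setC1 uv inE (ltn_eqF duk).
  by case: (u \in side v a) (u \in side v b) => [] [].
(* Both sides meet this level, so its two vertices cannot lie on the same side. *)
have uniq x y : 0 < d v x < k -> d v x = d v y ->
    (x \in side v a) = (y \in side v a) -> x = y.
  move=> dx dxy sxy; apply/eqP/negPn/negP; rewrite eq_sym => yx.
  have xk : 0 < d v x <= k by lia.
  have [p pa dp] := side_level va xk; have [q qb dq] := side_level vb xk.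
  have qa : q \notin side v a by rewrite -side_b ?dq.
  have pair := level_pair (proj1 (andP dx)) yx (esym dxy).
  case: (pair p dp) => Ep; case: (pair q dq) => Eq;
    by move: pa qa; rewrite Ep Eq ?sxy => ->.
have [x0 dx0] := top_exists.
(* On the last level both vertices belong to both sides, so the bit is chosen arbitrarily there,
   through [x0]. *)
exists (fun u => if d v u == k then u == x0 else u \in side v a); split.
  move=> x y dx dxy; rewrite -dxy; case: eqP => [dxk|dxk].
    have [y1 y1x dy1] : exists2 y1, y1 != x0 & d v y1 = d v x0.
      by apply: level_other; lia.
    have x0_gt0 : 0 < d v x0 by lia.
    have pair z : d v z = k -> z = x0 \/ z = y1.
      by rewrite -dx0; apply: level_pair.
    case: (pair x dxk) => ->; case: (pair y (etrans (esym dxy) dxk)) => ->;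
      by rewrite ?eqxx ?(negbTE y1x).
  apply: uniq => //; have := dist_max v x; lia.
move=> x y dxy; have [dx0'|dx_gt0] := posnP (d v x).
  have /eqP vx : d v x == 0 by rewrite dx0'.
  move: vx => /eqP; rewrite dist_eq0 // => /eqP vx; subst x.
  by rewrite /=; apply: dist_eq1 => //; rewrite dxy dx0'.
have := dist_max v y; rewrite leq_eqVlt => /predU1P[dyk|dyk] /=.
  by rewrite dyk eqxx; apply: top_adj => //; lia.
rewrite !ltn_eqF //=; last by lia.
have dxk : 0 < d v x < k by lia.
apply/idP/eqP => [xy|sxy].
  apply/idP/idP=> [xa|ya]; first exact: side_closed va xa xy dxy.
  have [//|xa] := boolP (x \in side v a); rewrite -side_b // in xa.
  have := side_closed vb xa xy dxy; rewrite side_b ?ya //; lia.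
have [z xz dz] := child dxk.
suff -> : y = z by [].
apply: uniq; [lia | lia |].
rewrite -sxy; apply/idP/idP=> [xa|za]; first exact: side_closed va xa xz dz.
have [//|xa] := boolP (x \in side v a); rewrite -side_b // in xa.
have := side_closed vb xa xz dz; rewrite side_b ?za //; lia.
Qed.

End Extremal.

End Stepwise.

(** * Coordinates and distances in the hatted cycle *)

Section HattedCycle.
Variable k : nat.
Hypothesis k_gt1 : 1 < k.

(** The arcs of the hatted cycle of order [k.*2.+1] on plain numbers, with the modulus replaced by
    an explicit wrap-around edge to suit linear arithmetic. *)
Definition hat_arc (i j : nat) :=
  [|| (j == i.+1) && (j < k.*2), (i == k.*2.-1) && (j == 0)
    | (i == k.*2) && ((j == 0) || (j == 2))].

Lemma hatted_cycleE (i j : 'I_k.*2.+1) :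
  hatted_cycle i j = hat_arc i j || hat_arc j i.
Proof.
have arcE (a b : 'I_k.*2.+1) : hatted_arc a b = hat_arc a b.
  rewrite /hatted_arc /hat_arc /=; case: (ltnP a k.*2) => /= ak.
    case: (a.+1 =P k.*2) => [aSk|/eqP aSk]; first by rewrite aSk modnn; lia.
    by rewrite modn_small; lia.
  by rewrite orbA -[LHS]orFb; congr (_ || _); lia.
by rewrite /hatted_cycle !arcE.
Qed.

(* The vertex of the hatted cycle at distance [i] from the antipode [k.+1] of
   [1] and its twin [k.*2], on the side given by [s]. *)
Definition hat_pos (i : nat) (s : bool) :=
  if i == 0 then k.+1
  else if i == k then (if s then 1 else k.*2)
  else if s then (if i == k.-1 then 0 else k.+1 + i) else k.+1 - i.

Lemma hat_pos_lt i s : i <= k -> hat_pos i s < k.*2.+1.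
Proof. by rewrite /hat_pos; case: s; do !case: ifP; lia. Qed.

Lemma hat_pos_inj i s j t : i <= k -> j <= k ->
  hat_pos i s = hat_pos j t -> i = j /\ (0 < i -> s = t).
Proof. by rewrite /hat_pos; case: s; case: t; do !case: ifP; lia. Qed.

(** The right-hand side is the adjacency rule of [extremal_structure]. *)
Lemma hat_pos_succ i s t : i < k ->
  hat_arc (hat_pos i s) (hat_pos i.+1 t) || hat_arc (hat_pos i.+1 t) (hat_pos i s) =
  [|| i == 0, i.+1 == k | s == t].
Proof.
rewrite /hat_pos /= => ik; have [->|i0] := eqVneq i 0.
  have /negbTE -> : 1 != k by lia.
  by rewrite /hat_arc /=; case: t; [case: (1 =P k.-1) => ? /= | rewrite /=]; lia.
have [ik1|ik1] := eqVneq i.+1 k; rewrite (ltn_eqF ik).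
  have -> : i == k.-1 by lia.
  by rewrite /hat_arc; case: s; case: t => /=; lia.
have /negbTE -> : i != k.-1 by lia.
case: s; case: t; rewrite /hat_arc /=.
- by case: (i.+1 =P k.-1) => ? /=; lia.
- by lia.
- by case: (i.+1 =P k.-1) => ? /=; lia.
- by apply/orP; right; apply/or3P; constructor 1; lia.
Qed.

Lemma hat_arc_levels i s j t : i <= k -> j <= k ->
  hat_arc (hat_pos i s) (hat_pos j t) -> j = i.+1 \/ i = j.+1.
Proof.
rewrite /hat_pos => ik jk.
by case: s; case: t; do !case: ifP => [/eqP ?|/eqP ?]; rewrite /hat_arc; lia.
Qed.
(* The distance to the vertex [k.+1]. *)
Definition hat_height (j : nat) :=
  if j == k.*2 then k else if j == 0 then k.-1 else (k.+1 - j) + (j - k.+1).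

Lemma hat_height_lip i j : hat_arc i j || hat_arc j i ->
  hat_height j <= (hat_height i).+1.
Proof. by rewrite /hat_height /hat_arc; do !case: ifP; lia. Qed.

Lemma sum_double_subl p q : (\sum_(j < p + q) (p - j)).*2 = p * p.+1.
Proof.
elim: q => [|q IH].
  rewrite addn0 -sum_double_sub; elim/big_ind2: _ => // x1 x2 y1 y2 <- <-.
  by rewrite doubleD.
by rewrite addnS big_ord_recr /= doubleD IH; lia.
Qed.

Lemma sum_double_subr p q : (\sum_(j < p + q) (j - p)).*2 = q * q.-1.
Proof.
elim: q => [|q IH]; first by rewrite addn0 big1 // => j _; have := ltn_ord j; lia.
by rewrite addnS big_ord_recr /= doubleD IH; case: q {IH} => [|q]; nia.
Qed.

Lemma sum_hat_height : \sum_(j < k.*2.+1) hat_height j = k * k.+1.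
Proof.
have E : k.*2 = k.+1 + k.-1 by lia.
(* The 2 corrects vertex 0, whose height is [k.-1] where the general formula gives [k.+1]; the final
   [k] is the height of vertex [k.*2]. *)
have : \sum_(j < k.*2.+1) hat_height j + 2 =
    \sum_(j < k.*2) (k.+1 - j) + \sum_(j < k.*2) (j - k.+1) + k.
  rewrite big_ord_recr /= {2}/hat_height eqxx -big_split /=.
  case Em : k.*2 => [|m]; first lia.
  rewrite !big_ord_recl /=.
  rewrite [in RHS](eq_bigr (fun j : 'I_m => hat_height (bump 0 j))).
    rewrite {1}/hat_height Em /=; lia.
  by move=> j _; have := ltn_ord j; rewrite /hat_height /= /bump; case: ifP; lia.
have := sum_double_subl k.+1 k.-1; have := sum_double_subr k.+1 k.-1.
rewrite -E; nia.
Qed.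

End HattedCycle.

(** * Equality case and conclusion *)

Lemma extremal_iso (T : finType) (e : rel T) k v :
  symmetric e -> connected_graph e -> STI e -> 1 < k -> #|T| = k.*2.+1 ->
  Tr e v = k * k.+1 -> graph_iso e (@hatted_cycle k.*2.+1).
Proof.
move=> e_sym e_conn e_STI k_gt1 order_T Tr_v.
have n_ge5 : 5 <= k.*2.+1 by lia.
have [s [s_inj s_adj]] :=
  extremal_structure e_sym e_conn order_T e_STI n_ge5 (erefl _) Tr_v.
have dmax u : dist e v u <= k.
  exact: (dist_max e_sym e_conn order_T e_STI n_ge5 (erefl _)).
pose f u : 'I_k.*2.+1 := Ordinal (hat_pos_lt k_gt1 (s u) (dmax u)).
exists f => [|x y].
  apply: inj_card_bij; last by rewrite card_ord order_T.
  move=> x y /(congr1 val) /= /(hat_pos_inj k_gt1 (dmax x) (dmax y)) [dxy].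
  have [dx0 _|dx /(_ isT) sxy] := posnP (dist e v x); last exact: s_inj.
  move/eqP: (dx0); rewrite dxy dist_eq0 // => /eqP <-.
  by move/eqP: (dx0); rewrite dist_eq0 // => /eqP.
have f_succ u w : dist e v w = (dist e v u).+1 ->
    hat_arc k (f u) (f w) || hat_arc k (f w) (f u) = e u w.
  move=> duw; rewrite (s_adj u w duw) /= duw hat_pos_succ //.
  by rewrite -duw dmax.
rewrite hatted_cycleE //.
have [dxy|dxy] := eqVneq (dist e v y) (dist e v x).+1; first exact: f_succ.
have [dyx|dyx] := eqVneq (dist e v x) (dist e v y).+1.
  by rewrite orbC e_sym f_succ.
(* Between levels that are not consecutive, neither graph has an edge. *)
have not_succ : ~ (dist e v y = (dist e v x).+1 \/ dist e v x = (dist e v y).+1).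
  by case; apply/eqP.
apply/idP/idP=> [arc | /(edge_level e_sym e_conn order_T e_STI v)]; last by case; lia.
by case: not_succ; case/orP: arc => /(hat_arc_levels k_gt1 (dmax _) (dmax _)); lia.
Qed.

(** Along edges [hat_height] grows by at most one and it vanishes at [k.+1], so it bounds the
    distances from there below. This suffices, since [Tr_le] gives the opposite inequality. *)
Lemma hatted_cycle_Tr (T : finType) (e : rel T) k :
  connected_graph e -> 1 < k -> graph_iso e (@hatted_cycle k.*2.+1) ->
  exists v, k * k.+1 <= Tr e v.
Proof.
move=> e_conn k_gt1 [f f_bij f_adj]; have [g fK gK] := f_bij.
have k1 : k.+1 < k.*2.+1 by lia.
exists (g (Ordinal k1)); rewrite TrE -(sum_hat_height k_gt1).
rewrite (reindex f) /=; last exact: onW_bij.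
apply: leq_sum => u _.
have := @dist_lipschitz T e e_conn (hat_height k \o f) (g (Ordinal k1)) u => /=.
have -> : hat_height k (f (g (Ordinal k1))) = 0.
  by rewrite gK /hat_height /=; case: ifP; lia.
apply=> x y; rewrite -f_adj hatted_cycleE // => /hat_height_lip; exact.
Qed.

Import Order.TTheory GRing.Theory Num.Theory.
Local Open Scope ring_scope.

Theorem theorem3p4 (T : finType) (e : rel T) (n : nat)
    (e_simple : simple_graph e) (e_connected : connected_graph e)
    (order_n : #|T| = n) (n_ge5 : (5 <= n)%N) (e_STI : STI e) :
  ((\max_(v : T) Tr e v)%:R <= (n%:R ^+ 2 - 1) / 4 :> rat) /\
  ((\max_(v : T) Tr e v)%:R = (n%:R ^+ 2 - 1) / 4 :> rat <->
   graph_iso e (@hatted_cycle n)).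
Proof.
have [e_sym _] := e_simple.
have n_odd : odd n by apply: (odd_order e_connected order_n e_STI); lia.
pose k := n./2; have n_k : n = k.*2.+1 by rewrite /k; lia.
have k_gt1 : (1 < k)%N by lia.
clearbody k; move: order_n; subst n => order_n.
have -> : (k.*2.+1%:R ^+ 2 - 1) / 4 = (k * k.+1)%:R :> rat.
  by rewrite -[k.*2.+1]addn1 -[k.+1]addn1 -muln2 !natrD !natrM; field.
have Tr_max v : (Tr e v <= k * k.+1)%N.
  exact: (Tr_le e_sym e_connected order_n e_STI n_ge5 (erefl _)).
have le_max : (\max_(v : T) Tr e v <= k * k.+1)%N by apply/bigmax_leqP.
rewrite ler_nat; split=> //; split=> [/eqP|iso].
  rewrite eqr_nat => /eqP max_eq.
  have [|v max_v] := @bigop.eq_bigmax T (Tr e); first by rewrite order_n.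
  by apply: (@extremal_iso _ _ _ v) => //; rewrite -max_v.
have [v lev] := hatted_cycle_Tr e_connected k_gt1 iso.
congr (_%:R); apply/eqP; rewrite eqn_leq le_max.
exact: leq_trans lev (leq_bigmax v).
Qed.
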